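(* Let $\Bbbk$ be a field and let $\sim$ be a homogeneous word relation. Then the vector space $\mathbf K^{(\sim)}$ is a graded sub-bialgebra of the $\Bbbk$-bialgebra $(\mathbf W,\nabla_{\mathrm{sh}},\iota_{\mathrm{sh}},\Delta_\odot,\epsilon_\odot)$ if and only if $\sim$ is algebraic.
   Context: Words. $\mathbb N=\{0,1,2,\dots\}$, $[n]=\{1,\dots,n\}$. A word is a finite sequence of positive integers; $\emptyset$ is the empty word, $\ell(w)$ the length, $\max(w)$ the largest letter, $\max(\emptyset)=0$. $w\uparrow m$, $w\downarrow m$: add, respectively subtract, $m$ to/from every letter. $w\cap S$: subword formed by omitting letters not in $S$. For words $u,v$ of lengths $m,n$, $u\sqcup\!\sqcup v$ is the sum, over $I\subset[m+n]$ with $|I|=m$, of the unique word of length $m+n$ whose restriction to positions in $I$ is $u$ and to the other positions is $v$. Word relations. A word relation is an equivalence relation $\sim$ on words such that $v\sim w$ only if $v,w$ have the same set of letters (multiplicities may differ). It is homogeneous if $v\sim w$ implies $\ell(v)=\ell(w)$. It is algebraic if for all words $v,w$: (a) if $v\sim v'$ and $w\sim w'$ then $vw\sim v'w'$ (concatenation); (b) if $v\sim w$ and $I=\{m+1,\dots,n\}$ with $m,n\in\mathbb N$, then $(v\cap I)\downarrow m\sim(w\cap I)\downarrow m$. The bialgebra $\mathbf W$. For $n\in\mathbb N$ let $\mathbb W_n$ be the set of pairs $[w,n]$ with $w$ a word and $\max(w)\le n$; $\mathbf W_n$ is the $\Bbbk$-vector space with basis $\mathbb W_n$ and $\mathbf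 W=\bigoplus_{n\in\mathbb N}\mathbf W_n$. It is graded with $[w,n]$ in degree $\ell(w)$. It is a graded bialgebra with product $\nabla_{\mathrm{sh}}([v,m]\otimes[w,n])=[v\sqcup\!\sqcup(w\uparrow m),m+n]$ (where $[\cdot,m+n]$ is extended linearly), unit $\iota_{\mathrm{sh}}(1)=[\emptyset,0]$, coproduct $\Delta_\odot([w,n])=\sum_{i=0}^{\ell(w)}[w_1\cdots w_i,n]\otimes[w_{i+1}\cdots w_{\ell(w)},n]$, and counit $\epsilon_\odot([w,n])=1$ if $w=\emptyset$ and $0$ otherwise. The subspace. For $n\in\mathbb N$ and a $\sim$-equivalence class $E$ of words with letters in $[n]$ let $\kappa_E^n=\sum_{w\in E}[w,n]$ (a finite sum when $\sim$ is homogeneous). $\mathbf K^{(\sim)}\subset\mathbf W$ is the $\Bbbk$-span of all $\kappa_E^n$ for all $n\in\mathbb N$ and all such $E$. *)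

(* Defs.v *)
From HB Require Import structures.
From mathcomp Require Import all_boot all_order all_algebra finmap.
From mathcomp Require Import boolp classical_sets functions cardinality fsbigop.
From mathcomp.multinomials Require Import freeg.
From Stdlib Require Import RelationClasses.

Set Implicit Arguments.
Unset Strict Implicit.
Unset Printing Implicit Defensive.

Import GRing.Theory.

Local Open Scope classical_set_scope.
Local Open Scope ring_scope.

Record letter := Letter { lval :> nat; _ : (0 < lval)%N }.
HB.instance Definition _ := [isSub for lval].
HB.instance Definition _ := [Countable of letter by <:].

Notation word := (seq letter).

Definition one_letter : letter := Letter (ltn0Sn 0).

Definition letter_add (m : nat) (x : letter) : letter :=
  insubd one_letter (x + m)%N.

(* Meaningful for m < x only; a letter x <= m is sent to 1. *)
Definition letter_sub (m : nat) (x : letter) : letter :=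
  insubd one_letter (x - m)%N.

Definition shiftup (w : word) (m : nat) : word := map (letter_add m) w.
Definition shiftdown (w : word) (m : nat) : word := map (letter_sub m) w.

Definition maxw (w : word) : nat := \max_(x <- w) (x : nat).

Definition wcap (w : word) (S : pred nat) : word := [seq x <- w | S (lval x)].

Lemma letter_addE m x : letter_add m x = (x + m)%N :> nat.
Proof. by rewrite /letter_add val_insubd addn_gt0; case: x => x /= ->. Qed.

Lemma letter_subE m (x : letter) :
  (m < x)%N -> letter_sub m x = (x - m)%N :> nat.
Proof. by move=> ltmx; rewrite /letter_sub val_insubd subn_gt0 ltmx. Qed.

Lemma maxw_leP (w : word) n :
  reflect (forall x : letter, x \in w -> (x <= n)%N) (maxw w <= n)%N.
Proof.
apply: (iffP (bigmax_leqP_seq _ _ _ _)) => [le_wn x xw|le_wn x xw _].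
  exact: le_wn.
exact: le_wn.
Qed.

Definition word_relation (sim : word -> word -> Prop) : Prop :=
  Equivalence sim /\ forall v w, sim v w -> v =i w.

Definition homogeneous (sim : word -> word -> Prop) : Prop :=
  forall v w, sim v w -> size v = size w.

Definition algebraic (sim : word -> word -> Prop) : Prop :=
  (forall v v' w w', sim v v' -> sim w w' -> sim (v ++ w) (v' ++ w')) /\
  (forall v w m n, sim v w ->
     let I : pred nat := fun i => (m < i <= n)%N in
     sim (shiftdown (wcap v I) m) (shiftdown (wcap w I) m)).

(* The word whose letters are taken in order from u at the positions where s is
   true and from v where it is false; for the subsets of positions used in
   [shuffle] it is characterized by [interleaveP]. *)
Fixpoint interleave (s : bitseq) (u v : word) : word :=
  match s, u, v with
  | true :: s', x :: u', _ => x :: interleave s' u' v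
  | false :: s', _, y :: v' => y :: interleave s' u v'
  | _, _, _ => [::]
  end.

Definition indicator (n : nat) (I : {set 'I_n}) : bitseq :=
  [seq i \in I | i <- enum 'I_n].

Lemma interleaveK (s : bitseq) (t : word) :
  size t = size s -> interleave s (mask s t) (mask (map negb s) t) = t.
Proof. by elim: s t => [|[] s IHs] [|x t] //= [/IHs ->]. Qed.

Lemma interleave_mask (s : bitseq) (u v : word) :
    count id s = size u -> size s = (size u + size v)%N ->
  [/\ size (interleave s u v) = size s, mask s (interleave s u v) = u
    & mask (map negb s) (interleave s u v) = v].
Proof.
move=> su ssv; have sv : count negb s = size v.
  by apply: (@addnI (size u)); rewrite -ssv -su; exact: count_predC.
elim: s u v su sv {ssv} => [|[] s IHs] u v /=; first by case: u; case: v.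
- case: u => // x u; rewrite !add1n add0n => -[su] sv.
  by have [e1 e2 e3] := IHs u v su sv; rewrite /= e1 e2 e3.
- case: v => [|y v]; rewrite add0n add1n // => su [sv].
  have [e1 e2 e3] := IHs u v su sv.
  by case: u su e1 e2 e3 => [|x u] su /= -> -> ->.
Qed.

Lemma interleaveP (s : bitseq) (u v t : word) :
    count id s = size u -> size s = (size u + size v)%N ->
  t = interleave s u v <->
  [/\ size t = size s, mask s t = u & mask (map negb s) t = v].
Proof.
move=> su ssv; split=> [->|[st <- <-]]; first exact: interleave_mask.
by rewrite interleaveK.
Qed.

Lemma size_indicator n (I : {set 'I_n}) : size (indicator I) = n.
Proof. by rewrite size_map size_enum_ord. Qed.

Lemma count_indicator n (I : {set 'I_n}) : count id (indicator I) = #|I|.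
Proof. by rewrite count_map cardE [in RHS]/enum_mem size_filter enumT. Qed.

(* The pair (w, n) stands for the basis element [w, n] of W. *)
Definition wpair := {p : word * nat | (maxw p.1 <= p.2)%N}.
HB.instance Definition _ := Choice.on wpair.

(* The direct sum of the W_n is the free module on the union of their bases,
   and a tensor product of free modules is the free module on pairs. *)
Notation "'W[' k ]" := {freeg wpair / k} (at level 0, format "'W[' k ]").
Notation "'W2[' k ]" :=
  {freeg (wpair * wpair)%type / k} (at level 0, format "'W2[' k ]").

Definition wsize (b : wpair) : nat := size (val b).1.

Section LinearAlgebra.
Variable k : fieldType.

Definition span (V : lmodType k) (S : set V) : set V :=
  [set x | exists r : seq (k * V),
     (forall c, c \in r -> S c.2) /\ x = \sum_(c <- r) c.1 *: c.2].

Definition linear_subspace (V : lmodType k) (S : set V) : Prop :=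
  S 0 /\ forall (c : k) x y, S x -> S y -> S (c *: x + y).

Definition tens (T : choiceType) (x y : {freeg T / k}) :
    {freeg (T * T)%type / k} :=
  fglift (fun a => fglift (fun b => << (a, b) >>) y) x.

(* The image of K (x) K in the tensor square. *)
Definition tens2 (T : choiceType) (K : set {freeg T / k}) :
    set {freeg (T * T)%type / k} :=
  span [set z | exists x y, [/\ K x, K y & z = tens x y]].

Definition component (T : choiceType) (deg : T -> nat) (d : nat)
    (x : {freeg T / k}) : {freeg T / k} :=
  fglift (fun b => if deg b == d then << b >> else 0) x.

(* A counit restricts to any subspace, so it imposes no condition on K. *)
Record graded_subbialgebra (T : choiceType) (deg : T -> nat)
    (nabla : {freeg (T * T)%type / k} -> {freeg T / k})
    (iota : k -> {freeg T / k})
    (Delta : {freeg T / k} -> {freeg (T * T)%type / k})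
    (epsilon : {freeg T / k} -> k) (K : set {freeg T / k}) : Prop := {
  subbialg_linear : linear_subspace K;
  subbialg_graded : forall x d, K x -> K (component deg d x);
  subbialg_mul : forall z, tens2 K z -> K (nabla z);
  subbialg_unit : forall c, K (iota c);
  subbialg_comul : forall x, K x -> tens2 K (Delta x)
}.

HB.instance Definition _ (T : choiceType) (V : lmodType k) (f : T -> V) :=
  GRing.isZmodMorphism.Build {freeg T / k} V (fglift f) (lift_is_additive f).

Lemma fglift_scalable (T : choiceType) (V : lmodType k) (f : T -> V) :
  scalable (fglift f).
Proof.
move=> c x; have -> : c *: x = \sum_(i <- dom x) << c * coeff i x *g i >> by [].
rewrite -[X in _ = _ *: fglift f X]freeg_sumE !raddf_sum /=.
by apply: eq_bigr => i _; rewrite !liftU scalerA.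
Qed.

HB.instance Definition _ (T : choiceType) (V : lmodType k) (f : T -> V) :=
  GRing.isScalable.Build k {freeg T / k} V *:%R (fglift f) (fglift_scalable f).

Lemma fgliftU (T : choiceType) (V : lmodType k) (f : T -> V) (a : T) :
  fglift f << a >> = f a.
Proof. by rewrite liftU scale1r. Qed.

End LinearAlgebra.

Section WBialgebra.
Variable k : fieldType.

(* [w, n]; only meaningful for maxw w <= n, and 0 otherwise. *)
Definition brk (n : nat) (w : word) : W[k] :=
  if insub (w, n) is Some b then << b >> else 0.

Definition shuffle (u v : word) : {freeg word / k} :=
  \sum_(I : {set 'I_(size u + size v)} | #|I| == size u)
    << interleave (indicator I) u v >>.

Definition nabla_sh (z : W2[k]) : W[k] :=
  fglift (fun ab : wpair * wpair =>
    let: (v, m) := val ab.1 in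
    let: (w, n) := val ab.2 in
    fglift (brk (m + n)) (shuffle v (shiftup w m))) z.

Definition iota_sh (c : k) : W[k] := c *: brk 0 [::].

Definition Delta_odot (x : W[k]) : W2[k] :=
  fglift (fun b : wpair =>
    let: (w, n) := val b in
    \sum_(i < (size w).+1) tens (brk n (take i w)) (brk n (drop i w))) x.

Definition epsilon_odot (x : W[k]) : k :=
  fglift (fun b : wpair => ((val b).1 == [::])%:R : k^o) x.

Variable sim : word -> word -> Prop.

Definition is_class (n : nat) (E : set word) : Prop :=
  (exists w, E = [set v | sim w v]) /\ forall v, E v -> (maxw v <= n)%N.

(* The library's sum over a set is 0 when the support is infinite; this does
   not happen for homogeneous sim by [finite_class]. *)
Definition kappa (n : nat) (E : set word) : W[k] := \sum_(w \in E) brk n w.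

Definition Ksim : set W[k] :=
  span [set x | exists n E, is_class n E /\ x = kappa n E].

Lemma brkE (b : wpair) : brk (val b).2 (val b).1 = << b >>.
Proof. by rewrite /brk -surjective_pairing valK. Qed.

Lemma maxw_shuffle (v w : word) m n (I : {set 'I_(size v + size w)}) :
    (maxw v <= m)%N -> (maxw w <= n)%N ->
  (maxw (interleave (indicator I) v (shiftup w m)) <= m + n)%N.
Proof.
move=> /maxw_leP vm /maxw_leP wn; apply/maxw_leP => x.
have sub s (u1 u2 : word) : {subset interleave s u1 u2 <= u1 ++ u2}.
  elim: s u1 u2 => [|[] s IHs] [|a u1] [|b u2] //= z; rewrite inE;
  case/predU1P => [->|/IHs]; rewrite ?(inE, mem_cat, eqxx, orbT) //=.
  - by move=> ->; rewrite orbT.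
  - by case/orP=> ->; rewrite !orbT.
  - by move=> ->; rewrite orbT.
  - by case/or3P=> ->; rewrite ?orbT.
move=> /sub; rewrite mem_cat => /orP[/vm xm|/mapP[y /wn yn ->]].
  exact: leq_trans xm (leq_addr _ _).
by rewrite letter_addE addnC leq_add2l.
Qed.

Lemma maxw_take_drop (w : word) n i : (maxw w <= n)%N ->
  (maxw (take i w) <= n)%N /\ (maxw (drop i w) <= n)%N.
Proof.
by move=> /maxw_leP wn; split; apply/maxw_leP => x;
   [move/mem_take | move/mem_drop]; exact: wn.
Qed.

Lemma finite_class n E : homogeneous sim -> is_class n E -> finite_set E.
Proof.
move=> hom [[w ->] le_n].
pose g (t : (size w).-tuple 'I_n.+1) : word :=
  [seq insubd one_letter (nat_of_ord i) | i <- tval t].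
apply: (@sub_finite_set _ _ (g @` setT)); last first.
  by apply: finite_image; exact: finite_finset.
move=> v wv; have sv : size (map (fun x : letter => inord x : 'I_n.+1) v)
    == size w by rewrite size_map (hom _ _ wv).
exists (Tuple sv) => //=; rewrite /g /= -map_comp -[RHS]map_id.
apply/eq_in_map => x xv /=; rewrite inordK ?valKd //.
by rewrite ltnS; exact: (maxw_leP _ _ (le_n _ wv)).
Qed.

End WBialgebra.

(* Main.v *)
From mathcomp Require Import all_boot all_algebra finmap.
From mathcomp Require Import boolp classical_sets cardinality fsbigop.
From mathcomp.multinomials Require Import freeg.
From Stdlib Require Import RelationClasses.
Require Import Defs.

(** The subspace K consists of the elements of W whose coefficients are
    constant along the relation on basis elements
      [v, m] ~ [w, n]  iff  m = n and v ~ w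
    ([wsim] and [KsimE] below): the class sums are the indicator functions of
    the (finite) classes, and an invariant element is peeled off into class
    sums one class at a time.  The same argument on pairs of basis elements
    identifies the image of the tensor square of K with the elements whose
    coefficients are constant along the product relation ([tens2_Ksim]).

    The structure maps become transparent on coefficients, since each sends a
    basis element to a sum of distinct basis elements:
    - the coefficient of Delta x at (a, b) is the coefficient of x at the
      concatenation of a and b, or 0 if their bounds differ ([coeff_Delta]);
    - the coefficient of nabla z at [t, N] is the sum, over m <= N, of the
      coefficient of z at the pair formed by the letters of t in {1, ..., m}
      and those in {m + 1, ..., N} lowered by m ([coeff_nabla]).  The two
      shuffled words use disjoint alphabets, so t determines them and the
      positions they occupy: all multiplicities are 1, whatever the
      characteristic.

    Hence if ~ is compatible with concatenation and with restriction to
    intervals, both maps preserve invariance.  Conversely, apply Delta to the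
    class sum of vw, and nabla to the tensor product of the class sums of the
    two slices of v: the coefficient at the evident basis element is 1, so
    invariance forces it to be 1 at every equivalent one, and this says that
    the concatenation, or the slices, of equivalent words are equivalent.
    General intervals {m + 1, ..., n} are obtained by cutting first at n, then
    at m. *)

Set Implicit Arguments.
Unset Strict Implicit.
Unset Printing Implicit Defensive.

Import GRing.Theory.
Local Open Scope classical_set_scope.
Local Open Scope ring_scope.

(** * Coefficients in free modules *)

Section FreeModule.
Variable k : fieldType.

Lemma natrb_eq1 (b : bool) : b%:R = 1 :> k -> b.
Proof. by case: b => // /esym/eqP; rewrite oner_eq0. Qed.

Lemma coeff_basis (T : choiceType) (a b : T) :
  coeff b (<< a >> : {freeg T / k}) = (a == b)%:R.
Proof. by rewrite coeffU mul1r. Qed.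

Lemma freeg_basis_ind (T : choiceType) (P : {freeg T / k} -> Prop) :
    P 0 -> (forall c a x, P x -> P (c *: << a >> + x)) -> forall x, P x.
Proof.
move=> P0 PD x; rewrite -(freeg_sumE x).
elim: (dom x) => [|a r IHr]; first by rewrite big_nil.
rewrite big_cons.
have -> : << coeff a x *g a >> = coeff a x *: << a >> :> {freeg T / k}.
  by apply/eqP/freeg_eqP => b; rewrite coeffZ !coeffU mul1r.
exact: PD.
Qed.

Lemma coeff_tens (T : choiceType) (a b : T) (x y : {freeg T / k}) :
  coeff (a, b) (tens x y) = coeff a x * coeff b y.
Proof.
rewrite /tens; elim/freeg_basis_ind: x => [|c a' x IHx].
  by rewrite !raddf0 mul0r.
rewrite linearP /= !coeffD !coeffZ IHx fgliftU mulrDl -mulrA; congr (_ * _ + _).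
rewrite coeff_basis; elim/freeg_basis_ind: y {IHx} => [|d b' y IHy].
  by rewrite !raddf0 mulr0.
rewrite linearP /= !coeffD !coeffZ IHy fgliftU !coeff_basis mulrDr.
by rewrite xpair_eqE -mulnb natrM mulrCA.
Qed.

(** The multiset [r] encodes the row at [u] of the matrix of [fglift f], whose
    entries are natural numbers; reading off the coefficient at [u] is then
    summation over that row. *)
Lemma coeff_fglift (T U : choiceType) (f : T -> {freeg U / k}) (u : U)
    (r : seq T) (x : {freeg T / k}) :
    (forall a, coeff u (f a) = (count_mem a r)%:R) ->
  coeff u (fglift f x) = \sum_(b <- r) coeff b x.
Proof.
move=> coeff_f; elim/freeg_basis_ind: x => [|c a x IHx].
  by rewrite !raddf0 big1 // => b _; rewrite coeff0.
rewrite linearP /= coeffD coeffZ IHx fgliftU coeff_f.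
under [RHS]eq_bigr do rewrite coeffD coeffZ.
rewrite big_split -mulr_sumr; congr (_ * _ + _).
elim: r {IHx coeff_f} => [|b r IHr]; first by rewrite big_nil.
by rewrite big_cons -IHr coeff_basis /= natrD eq_sym.
Qed.

Lemma coeff_component (T : choiceType) (deg : T -> nat) d (a : T)
    (x : {freeg T / k}) :
  coeff a (component deg d x) = if deg a == d then coeff a x else 0.
Proof.
rewrite /component (coeff_fglift (r := if deg a == d then [:: a] else [::])).
  by case: ifP; rewrite ?big_seq1 ?big_nil.
move=> b; have [->|ba] := eqVneq b a.
  by case: ifP => _; rewrite ?coeff_basis ?coeff0 /= ?eqxx.
have -> : count_mem b (if deg a == d then [:: a] else [::]) = 0%N.
  by case: ifP => //= _; rewrite eq_sym (negbTE ba).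
by case: ifP => _; rewrite ?coeff_basis ?coeff0 // (negbTE ba).
Qed.

(** * Invariant elements and class sums *)

Lemma linear_subspace_span (V : lmodType k) (K S : set V) :
  linear_subspace K -> S `<=` K -> span S `<=` K.
Proof.
move=> [K0 KD] SK x [r [rS ->]]; elim: r rS => [|c r IHr] rS.
  by rewrite big_nil.
rewrite big_cons; apply: KD; first by apply/SK/rS; rewrite inE eqxx.
by apply: IHr => d dr; apply: rS; rewrite inE dr orbT.
Qed.

Lemma span_linear (V : lmodType k) (S : set V) : linear_subspace (span S).
Proof.
split=> [|c _ _ [r [rS ->]] [s [sS ->]]]; first by exists [::]; rewrite big_nil.
exists ([seq (c * d.1, d.2) | d <- r] ++ s); split=> [d|].
  by rewrite mem_cat => /orP[/mapP[e /rS eS ->]|/sS].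
rewrite big_cat big_map scaler_sumr; congr (_ + _).
by apply: eq_bigr => d _; rewrite scalerA.
Qed.

Lemma sub_span (V : lmodType k) (S : set V) : S `<=` span S.
Proof.
move=> x Sx; exists [:: (1, x)]; split=> [c|]; last by rewrite big_seq1 scale1r.
by rewrite inE => /eqP ->.
Qed.

Definition invariant (T : choiceType) (R : T -> T -> Prop) :
    set {freeg T / k} :=
  [set x | forall a b, R a b -> coeff a x = coeff b x].

Lemma invariant_linear (T : choiceType) (R : T -> T -> Prop) :
  linear_subspace (invariant R).
Proof.
split=> [a b _|c x y xR yR a b ab]; first by rewrite !coeff0.
by rewrite !coeffD !coeffZ (xR a b ab) (yR a b ab).
Qed.

Lemma invariant_class (T : choiceType) (R : T -> T -> Prop)
    (e : T -> {freeg T / k}) :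
    Equivalence R -> (forall a b, coeff b (e a) = `[< R a b >]%:R) ->
  forall a, invariant R (e a).
Proof.
move=> eqR coeff_e a b c bc; rewrite !coeff_e; congr (nat_of_bool _)%:R.
apply: asbool_equiv_eq; split=> ?; first by transitivity b.
by transitivity c; last symmetry.
Qed.

(** By induction on the size of the support: subtracting from x the right
    multiple of the class sum of a point of the support kills the coefficients
    on that whole class and changes no other.  In particular the finiteness of
    the classes is encoded in the existence of the [e a]. *)
Lemma invariant_sub_span (T : choiceType) (R : T -> T -> Prop)
    (e : T -> {freeg T / k}) (S : set {freeg T / k}) :
    Equivalence R -> (forall a b, coeff b (e a) = `[< R a b >]%:R) ->
    (forall a, S (e a)) ->
  invariant R `<=` span S.
Proof.
move=> eqR coeff_e Se x; have [n] := ubnP (size (dom x)).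
have [S0 SD] := span_linear S.
elim: n x => // n IHn x; rewrite ltnS => le_n Rx.
case domx: (dom x) => [|a r].
  by have /eqP -> : x == 0 by rewrite -dom_eq0 domx.
have ax : a \in dom x by rewrite domx inE eqxx.
have Re := invariant_class eqR coeff_e a.
have coeff_y b : coeff b (x - coeff a x *: e a) =
    if `[< R a b >] then 0 else coeff b x.
  rewrite coeffB coeffZ coeff_e; case: asboolP => [/Rx ->|_].
    by rewrite mulr1 subrr.
  by rewrite mulr0 subr0.
rewrite -[x](subrK (coeff a x *: e a)) addrC.
apply: SD; first exact/sub_span/Se.
apply: IHn => [|b c bc]; last first.
  by rewrite !coeffB !coeffZ (Rx b c bc) (Re b c bc).
apply: leq_trans le_n; rewrite domx ltnS.
(* The new support lies in r: it has lost a. *)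
apply: uniq_leq_size; first exact: uniq_dom.
move=> b; rewrite mem_dom coeff_y; case: asboolP => [_|Rab bx].
  by rewrite eqxx.
have : b \in dom x by rewrite mem_dom.
rewrite domx inE => /predU1P[ba|//]; case: Rab; rewrite ba; reflexivity.
Qed.

Definition pair_rel (T : Type) (R : T -> T -> Prop) (p q : T * T) : Prop :=
  R p.1 q.1 /\ R p.2 q.2.

Lemma pair_rel_equivalence (T : Type) (R : T -> T -> Prop) :
  Equivalence R -> Equivalence (pair_rel R).
Proof.
move=> eqR; split; first by move=> p; split; reflexivity.
  by move=> p q [pq1 pq2]; split; symmetry.
move=> p q r [pq1 pq2] [qr1 qr2].
by split; [transitivity q.1|transitivity q.2].
Qed.

(** The class sum of a pair for the product relation is the tensor product of
    the two class sums, so that [invariant_sub_span] applies to pairs. *)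
Lemma tens2_invariant (T : choiceType) (R : T -> T -> Prop)
    (e : T -> {freeg T / k}) :
    Equivalence R -> (forall a b, coeff b (e a) = `[< R a b >]%:R) ->
  tens2 (invariant R) = invariant (pair_rel R).
Proof.
move=> eqR coeff_e; rewrite eqEsubset; split.
  apply: linear_subspace_span; first exact: invariant_linear.
  move=> _ [x [y [Rx Ry ->]]] [a b] [c d] [/= ac bd].
  by rewrite !coeff_tens (Rx a c ac) (Ry b d bd).
have Re := invariant_class eqR coeff_e.
apply: (@invariant_sub_span _ _ (fun p => tens (e p.1) (e p.2))).
- exact: pair_rel_equivalence.
- by move=> [a b] [c d]; rewrite coeff_tens !coeff_e -natrM mulnb asbool_and.
- by move=> p; exists (e p.1), (e p.2).
Qed.

End FreeModule.

(** * Interleavings of words over disjoint alphabets *)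

Lemma map_interleave (p : pred letter) s (u v : word) :
    all p u -> all (predC p) v -> count id s = size u ->
    size s = (size u + size v)%N ->
  map p (interleave s u v) = s.
Proof.
move=> pu pv su ssv; have sv : count negb s = size v.
  by apply: (@addnI (size u)); rewrite -ssv -su; exact: count_predC.
elim: s u v pu pv su sv {ssv} => [|[] s IHs] [|x u] [|y v] //=;
  rewrite ?addn0 ?add0n ?add1n //.
- by case/andP=> px pu pv [su] sv; rewrite px IHs.
- by case/andP=> px pu pv [su] sv; rewrite px IHs.
- by move=> pu /andP[/negbTE py pv] su [sv]; rewrite py IHs.
- by move=> pu /andP[/negbTE py pv] su [sv]; rewrite py IHs.
Qed.

(** When [p] separates the letters of [u] from those of [v], the word [t]
    determines [u], [v] and the positions [s] that give it as a shuffle. *)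
Lemma interleave_eqP (p : pred letter) s (u v t : word) :
    all p u -> all (predC p) v -> count id s = size u ->
    size s = (size u + size v)%N ->
  t = interleave s u v <->
  [/\ s = map p t, filter p t = u & filter (predC p) t = v].
Proof.
move=> pu pv su ssv.
have tC : map (predC p) t = map negb (map p t) by rewrite -map_comp.
rewrite interleaveP // !filter_mask tC; split.
  move=> [st ut vt]; have e : s = map p t.
    by rewrite -(interleaveK st) ut vt map_interleave.
  by rewrite -e.
by move=> [-> <- <-]; rewrite size_map.
Qed.

Lemma indicator_inj n : injective (@indicator n).
Proof.
move=> I J IJ; apply/setP => i.
have in_nth (K : {set 'I_n}) : nth false (indicator K) i = (i \in K).
  by rewrite (nth_map i) ?size_enum_ord // nth_ord_enum.
by rewrite -!in_nth IJ.
Qed.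

Lemma indicator_surj n (s : bitseq) : size s = n ->
  exists I : {set 'I_n}, indicator I = s.
Proof.
move=> sn; exists (finset (fun i : 'I_n => nth false s i)).
apply: (@eq_from_nth _ false); first by rewrite size_indicator.
move=> i; rewrite size_indicator => lt_in; pose i0 := Ordinal lt_in.
by rewrite (nth_map i0) ?size_enum_ord // (nth_ord_enum i0 i0) finset.inE.
Qed.

(** * Slices and concatenations of basis elements *)

Lemma shiftupK w m : shiftdown (shiftup w m) m = w.
Proof.
rewrite /shiftdown -map_comp -[RHS]map_id; apply: eq_map => x /=.
have x0 : (0 < x)%N by case: x.
apply: val_inj; rewrite /= letter_subE ?letter_addE ?addnK //.
by rewrite -[ltnLHS]add0n ltn_add2r.
Qed.

Lemma shiftdownK w m : all (fun x : letter => m < x)%N w ->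
  shiftup (shiftdown w m) m = w.
Proof.
move=> /allP mw; rewrite /shiftup -map_comp -[RHS]map_id.
apply/eq_in_map => x /mw mx /=; apply: val_inj.
by rewrite /= letter_addE letter_subE // subnK // ltnW.
Qed.

Lemma shiftdown0 w : shiftdown w 0 = w.
Proof.
rewrite /shiftdown -[RHS]map_id; apply: eq_map => x.
have x0 : (0 < x)%N by case: x.
by apply: val_inj; rewrite /= letter_subE // subn0.
Qed.

Lemma maxw_slice m n (w : word) :
  (maxw (shiftdown (wcap w (fun i => m < i <= n)%N) m) <= n - m)%N.
Proof.
apply/maxw_leP => _ /mapP[x + ->]; rewrite mem_filter => /andP[/andP[mx xn] _].
by rewrite letter_subE // leq_sub2r.
Qed.

(** The bound is lowered along with the letters, so that the slices of [t, N]
    over {1, ..., m} and {m + 1, ..., N} have bounds adding up to N. *)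
Definition slice (m n : nat) (b : wpair) : wpair :=
  exist _ (shiftdown (wcap (val b).1 (fun i => m < i <= n)%N) m, (n - m)%N)
    (maxw_slice m n (val b).1).

Lemma slice_lowE m (b : wpair) :
  val (slice 0 m b) = (filter [pred x : letter | x <= m]%N (val b).1, m).
Proof.
rewrite /= shiftdown0 subn0; congr (_, _); apply: eq_filter => x /=.
by case: x => x /= ->.
Qed.

Lemma maxw_cat (a b : wpair) :
  (maxw ((val a).1 ++ (val b).1) <= maxn (val a).2 (val b).2)%N.
Proof.
rewrite /maxw big_cat leq_max /=; case: a b => [[v m] /= vm] [[w n] /= wn].
rewrite !geq_max; case: (leqP m n) => [mn|/ltnW nm].
  by rewrite wn (leq_trans vm mn) orbT.
by rewrite vm (leq_trans wn nm).
Qed.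

(** The maximum makes the operation total; when the two bounds agree it is
    their common value. *)
Definition concat (a b : wpair) : wpair :=
  exist _ ((val a).1 ++ (val b).1, maxn (val a).2 (val b).2) (maxw_cat a b).

(** * The coproduct and the product on coefficients *)

Section WordAlgebra.
Variable k : fieldType.

Lemma coeff_brk n w (b : wpair) : (maxw w <= n)%N ->
  coeff b (brk k n w) = ((w, n) == val b)%:R.
Proof.
move=> wn; rewrite /brk; case: insubP => [c _ <-|/negP//].
by rewrite coeff_basis.
Qed.

(** A pair (a, b) with equal bounds arises from exactly one cut, that of the
    word [a.1 ++ b.1] after its first [size a.1] letters. *)
Lemma coeff_Delta (a b : wpair) (x : W[k]) :
  coeff (a, b) (Delta_odot x) =
  if (val a).2 == (val b).2 then coeff (concat a b) x else 0.
Proof.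
rewrite /Delta_odot (coeff_fglift
  (r := if (val a).2 == (val b).2 then [:: concat a b] else [::])).
  by case: ifP; rewrite ?big_seq1 ?big_nil.
case=> -[w n] wn /=; rewrite raddf_sum /=.
have coeff_cut i :
    coeff (a, b) (tens (brk k n (take i w)) (brk k n (drop i w))) =
    (((take i w, n) == val a) && ((drop i w, n) == val b))%:R.
  have [tn dn] := maxw_take_drop i wn.
  by rewrite coeff_tens !coeff_brk // -natrM mulnb.
under eq_bigr do rewrite coeff_cut.
case: a b {coeff_cut} => [[v m] vm] [[u p] up] /=.
(* A cut keeps the bound n on both sides, so m and p must agree. *)
have [mp|mp] := eqVneq m p; last first.
  rewrite big1 // => i _; rewrite !xpair_eqE.
  by case: (n =P m) => [->|]; rewrite ?(negbTE mp) ?andbF.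
subst p; rewrite /= addn0 -val_eqE /= maxnn xpair_eqE.
have [e|ne] := boolP ((v ++ u == w) && (m == n)); last first.
  rewrite big1 // => i _; case: andP => // -[/eqP[tv nm] /eqP[du _]].
  by case/negP: ne; rewrite -tv -du cat_take_drop nm !eqxx.
case/andP: e wn => /eqP <- /eqP <- wn.
have lt_v : (size v < (size (v ++ u)).+1)%N by rewrite ltnS size_cat leq_addr.
(* The cut at size v is the only one whose left part is v. *)
rewrite (bigD1 (Ordinal lt_v)) //= take_size_cat // drop_size_cat // !eqxx.
rewrite big1 ?addr0 // => i; apply: contraNeq; rewrite -val_eqE /=.
case: andP => [[/eqP[tv] _] _|_]; last by rewrite eqxx.
by move/(congr1 size): tv; rewrite size_takel -1?ltnS // => ->.
Qed.

(** The pair (a, b) contributes to t exactly when it is a pair of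
    complementary slices of t, and then through the single set of positions
    occupied by the letters of t that are at most the bound of a. *)
Lemma coeff_nabla (t : wpair) (z : W2[k]) :
  coeff t (nabla_sh z) =
  \sum_(m < (val t).2.+1) coeff (slice 0 m t, slice m (val t).2 t) z.
Proof.
pose g m := (slice 0 m t, slice m (val t).2 t).
rewrite -(big_mkord xpredT (fun m => coeff (g m) z)) /index_iota subn0.
rewrite -(big_map g xpredT (fun b => coeff b z)).
have g_inj : injective g.
  move=> m n /(congr1 (fun p : wpair * wpair => (val p.1).2)).
  by rewrite /= !subn0.
rewrite /nabla_sh; apply: coeff_fglift => -[a b].
rewrite count_uniq_mem; last by rewrite map_inj_uniq // iota_uniq.
case: a b => [[v m] vm] [[w n] wn].
rewrite [X in coeff t X]/= /shuffle !raddf_sum.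
set a : wpair := exist _ (v, m) vm; set b : wpair := exist _ (w, n) wn.
set sh := shiftup w m; set N := (val t).2; set t1 := (val t).1.
pose low := [pred x : letter | (x <= m)%N].
have low_v : all low v by apply/allP => x /(maxw_leP v m vm).
have high_sh : all (predC low) sh.
  apply/allP => _ /mapP[x _ ->]; rewrite /= letter_addE -ltnNge.
  by rewrite -[ltnLHS]add0n ltn_add2r; case: x.
have mem_gE : ((a, b) \in map g (iota 0 N.+1)) =
    [&& (m + n)%N == N, filter low t1 == v & filter (predC low) t1 == sh].
  have highE : wcap t1 (fun i => m < i <= N)%N = filter (predC low) t1.
    apply: eq_in_filter => x /(maxw_leP _ _ (valP t)) xN.
    by rewrite /= -/N xN andbT ltnNge.
  have all_high : all (fun x : letter => m < x)%N (filter (predC low) t1).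
    by apply/allP => x; rewrite mem_filter /= -ltnNge => /andP[].
  apply/mapP/and3P => [[m' m'N e]|[/eqP mnN /eqP tv /eqP tsh]].
    have := congr1 (fun p : wpair * wpair => val p.1) e.
    rewrite [RHS]slice_lowE => -[ev em].
    have := congr1 (fun p : wpair * wpair => val p.2) e.
    rewrite -em /= -/N -/t1 highE => -[ew en].
    rewrite /sh ev en ew shiftdownK // -em subnKC; last first.
      by move: m'N; rewrite mem_iota -em.
    by split.
  exists m; first by rewrite mem_iota ltnS -mnN leq_addr.
  congr (_, _); apply: val_inj; rewrite ?slice_lowE /= -/N -/t1 ?tv //.
  by rewrite highE tsh /sh shiftupK -mnN addKn.
(* Stated for p = size w only propositionally, since size sh does not reduce
   to size w. *)
have max_inter p (J : {set 'I_(size v + p)}) : p = size w ->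
    (maxw (interleave (indicator J) v sh) <= m + n)%N.
  move=> ep; subst p; exact: (maxw_shuffle J vm wn).
have interE (I : {set 'I_(size v + size sh)}) : #|I| == size v ->
    coeff t (fglift (brk k (m + n)) << interleave (indicator I) v sh >>) =
    (((a, b) \in map g (iota 0 N.+1)) && (indicator I == map low t1))%:R.
  move=> /eqP cardI; rewrite fgliftU coeff_brk; last first.
    by apply: max_inter; exact: size_map.
  rewrite mem_gE.
  congr (nat_of_bool _)%:R.
  rewrite [val t]surjective_pairing xpair_eqE -/t1 -/N.
  have iff_t := @interleave_eqP low (indicator I) v sh t1 low_v high_sh.
  have {}iff_t := iff_t (etrans (count_indicator I) cardI) (size_indicator I).
  apply/andP/andP => [[/eqP/esym/iff_t[-> tv tsh] mnN]|].
    by rewrite mnN tv tsh !eqxx.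
  case=> /and3P[mnN /eqP tv /eqP tsh] /eqP It; split=> //.
  by apply/eqP/esym/iff_t.
rewrite (eq_bigr _ interE).
have [e|_] := boolP ((a, b) \in map g (iota 0 N.+1)); last by rewrite big1.
move: e; rewrite mem_gE => /and3P[_ /eqP tv /eqP tsh].
have size_t : size (map low t1) = (size v + size sh)%N.
  by rewrite size_map -tv -tsh !size_filter count_predC.
have [I0 I0t] := indicator_surj size_t.
rewrite (bigD1 I0) /=; last first.
  by rewrite -count_indicator I0t count_map -tv size_filter.
rewrite I0t eqxx big1 ?addr0 // => I /andP[_ nI].
by rewrite -I0t (inj_eq (@indicator_inj _)) (negbTE nI).
Qed.

(** * The subspace attached to a word relation *)

Section Relation.
Variable sim : word -> word -> Prop.
Hypotheses (sim_rel : word_relation sim) (sim_hom : homogeneous sim).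

#[local] Instance sim_equivalence : Equivalence sim := sim_rel.1.

Definition wsim (a b : wpair) : Prop :=
  (val a).2 = (val b).2 /\ sim (val a).1 (val b).1.

#[local] Instance wsim_equivalence : Equivalence wsim.
Proof.
split=> [a|a b [ab1 ab2]|a b c [ab1 ab2] [bc1 bc2]].
- by split=> //; reflexivity.
- by split; [rewrite ab1 | symmetry].
- by split; [rewrite ab1 | transitivity (val b).1].
Qed.

(** Equivalent words have the same letters, so the bound n never separates
    them: every class meeting the words bounded by n stays inside. *)
Lemma maxw_sim v w n : sim v w -> (maxw v <= n)%N -> (maxw w <= n)%N.
Proof.
move=> vw /maxw_leP vn; apply/maxw_leP => x.
by rewrite -(sim_rel.2 _ _ vw); exact: vn.
Qed.

Definition class_sum (a : wpair) : W[k] :=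
  kappa k (val a).2 [set v | sim (val a).1 v].

Lemma is_class_sim (a : wpair) :
  is_class sim (val a).2 [set v | sim (val a).1 v].
Proof.
by split=> [|v av]; [exists (val a).1 | exact: maxw_sim av (valP a)].
Qed.

Lemma coeff_class_sum (a b : wpair) :
  coeff b (class_sum a) = `[< wsim a b >]%:R.
Proof.
have clE := is_class_sim a; have finE := finite_class sim_hom clE.
rewrite /class_sum /kappa fsbig_finite // raddf_sum.
case: b => [[w n] wn] /=.
have coeffE v : v \in fset_set [set v | sim (val a).1 v] ->
    coeff (exist _ (w, n) wn : wpair) (brk k (val a).2 v) =
    ((v == w) && ((val a).2 == n))%:R.
  by rewrite in_fset_set // inE => /clE.2 va; rewrite coeff_brk // xpair_eqE.
rewrite big_seq (eq_bigr _ coeffE) -big_seq.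
have [wa|wa] := boolP (w \in fset_set [set v | sim (val a).1 v]); last first.
  rewrite asboolF => [|[_ /= aw]]; last first.
    by case/negP: wa; rewrite in_fset_set // inE.
  rewrite big_seq big1 // => v va; case: eqP => // vw.
  by rewrite -vw va in wa.
rewrite (bigD1_seq w) ?fset_uniq //= eqxx big1 ?addr0 => [|v /negbTE -> //].
congr (nat_of_bool _)%:R; apply/eqP/asboolP => [an|[]//].
by split=> //=; move: wa; rewrite in_fset_set // inE.
Qed.

Lemma KsimE : @Ksim k sim = invariant wsim.
Proof.
rewrite eqEsubset; split.
  apply: linear_subspace_span; first exact: invariant_linear.
  move=> _ [n [E [[[w ->] le_n] ->]]].
  have wn : (maxw w <= n)%N by apply: le_n => /=; reflexivity.
  exact: (invariant_class wsim_equivalence coeff_class_sum (exist _ (w, n) wn)).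
apply: (invariant_sub_span wsim_equivalence coeff_class_sum).
move=> a; exists (val a).2, [set v | sim (val a).1 v].
by split=> //; exact: is_class_sim.
Qed.

Lemma tens2_Ksim : tens2 (@Ksim k sim) = invariant (pair_rel wsim).
Proof.
by rewrite KsimE; exact: tens2_invariant wsim_equivalence coeff_class_sum.
Qed.

Lemma class_sum_in (a : wpair) : @Ksim k sim (class_sum a).
Proof.
by rewrite KsimE; exact: invariant_class wsim_equivalence coeff_class_sum a.
Qed.

(** * Algebraic relations give sub-bialgebras *)

Lemma subbialgebra_of_algebraic : algebraic sim ->
  graded_subbialgebra wsize (@nabla_sh k) (@iota_sh k) (@Delta_odot k)
    (@epsilon_odot k) (@Ksim k sim).
Proof.
move=> [sim_cat sim_slice].
have slice_sim m n a b : wsim a b -> wsim (slice m n a) (slice m n b).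
  by move=> [_ ab]; split=> //=; exact: sim_slice.
have concat_sim a b c d :
    wsim a c -> wsim b d -> wsim (concat a b) (concat c d).
  by move=> [ac1 ac2] [bd1 bd2]; split=> /=; [rewrite ac1 bd1|exact: sim_cat].
split; rewrite ?tens2_Ksim KsimE.
- exact: invariant_linear.
- move=> x d xK a b ab; rewrite !coeff_component (xK a b ab).
  by rewrite /wsize (sim_hom ab.2).
- move=> z zK a b ab; rewrite !coeff_nabla -ab.1; apply: eq_bigr => m _.
  by apply: zK; split; exact: slice_sim.
- move=> c a b ab; rewrite /iota_sh !coeffZ !coeff_brk ?/maxw ?big_nil //.
  rewrite [val a]surjective_pairing [val b]surjective_pairing !xpair_eqE ab.1.
  by rewrite ![[::] == _]eq_sym -!size_eq0 (sim_hom ab.2).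
- move=> x xK [a b] [c d] [/= ac bd]; rewrite !coeff_Delta ac.1 bd.1.
  by case: ifP => // _; apply: xK; exact: concat_sim.
Qed.

(** * Sub-bialgebras come from algebraic relations *)

Section Converse.
Hypothesis K_sub : graded_subbialgebra wsize (@nabla_sh k) (@iota_sh k)
  (@Delta_odot k) (@epsilon_odot k) (@Ksim k sim).

(** Invariance of Delta applied to the class sum of [concat a b], whose
    coefficient at (a, b) is 1. *)
Lemma concat_sim_of_sub (a b c d : wpair) :
    (val a).2 = (val b).2 -> wsim a c -> wsim b d ->
  wsim (concat a b) (concat c d).
Proof.
move=> ab ac bd; apply/asboolP/(@natrb_eq1 k).
have := subbialg_comul K_sub (class_sum_in (concat a b)).
rewrite tens2_Ksim => /(_ (a, b) (c, d) (conj ac bd)).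
rewrite !coeff_Delta -ac.1 -bd.1 ab eqxx !coeff_class_sum => <-.
rewrite asboolT //; reflexivity.
Qed.

(** Invariance of the product of the class sums of the two slices of [a]: its
    coefficient at [a] is 1, and its coefficient at [b] is the truth value of
    the conclusion. *)
Lemma slice_sim_of_sub (a b : wpair) m : (m <= (val a).2)%N -> wsim a b ->
  wsim (slice 0 m a) (slice 0 m b) /\
  wsim (slice m (val a).2 a) (slice m (val a).2 b).
Proof.
move=> le_m ab; set N := (val a).2.
pose z : W2[k] := tens (class_sum (slice 0 m a)) (class_sum (slice m N a)).
have Kz : tens2 (@Ksim k sim) z.
  apply: sub_span; exists (class_sum (slice 0 m a)), (class_sum (slice m N a)).
  by split=> //; exact: class_sum_in.
have coeff_z c : (val c).2 = N -> coeff c (nabla_sh z) =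
    `[< wsim (slice 0 m a) (slice 0 m c) /\
        wsim (slice m N a) (slice m N c) >]%:R.
  move=> cN; rewrite coeff_nabla cN (bigD1 (Ordinal (le_m : (m < N.+1)%N))) //=.
  rewrite coeff_tens !coeff_class_sum -natrM mulnb -asbool_and big1 ?addr0 //.
  (* The bound m of the first factor singles out the summand of index m. *)
  move=> i ni; rewrite coeff_tens !coeff_class_sum asboolF ?mul0r //.
  by case=> /= + _; rewrite !subn0 => mi; case/eqP: ni; exact: val_inj.
apply/asboolP/(@natrb_eq1 k); rewrite -(coeff_z b (esym ab.1)).
have := subbialg_mul K_sub Kz; rewrite KsimE => /(_ a b ab) <-.
by rewrite coeff_z // asboolT //; split; reflexivity.
Qed.

Lemma algebraic_of_subbialgebra : algebraic sim.
Proof.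
split=> [v v' w w' vv' ww'|v w m n vw I].
  pose n := maxn (maxw v) (maxw w).
  have vn : (maxw v <= n)%N := leq_maxl _ _.
  have wn : (maxw w <= n)%N := leq_maxr _ _.
  by case: (@concat_sim_of_sub (exist _ (v, n) vn) (exist _ (w, n) wn)
    (exist _ (v', n) (maxw_sim vv' vn)) (exist _ (w', n) (maxw_sim ww' wn))
    erefl (conj erefl vv') (conj erefl ww')).
(* An empty interval leaves the empty word; otherwise m is a legitimate place
   to cut the slice of bound n. *)
have [nm|mn] := leqP n m.
  have nil u : wcap u I = [::].
    rewrite /wcap -(filter_pred0 u); apply: eq_filter => x /=.
    by apply/negP => /andP[/leq_trans mx /mx]; rewrite ltnNge nm.
  by rewrite !nil; reflexivity.
pose N := maxn n (maxw v).
have vN : (maxw v <= N)%N := leq_maxr _ _.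
pose a : wpair := exist _ (v, N) vN.
pose b : wpair := exist _ (w, N) (maxw_sim vw vN).
have [ab _] := @slice_sim_of_sub a b n (leq_maxl _ _) (conj erefl vw).
have m_le : (m <= (val (slice 0 n a)).2)%N by rewrite /= subn0 ltnW.
have [_ [_]] := slice_sim_of_sub m_le ab.
have capE u : wcap (shiftdown (wcap u (fun i => 0 < i <= n)%N) 0)
    (fun i => m < i <= n - 0)%N = wcap u I.
  rewrite shiftdown0 subn0 /wcap -filter_predI; apply: eq_filter => x /=.
  by case: x => x /= x0; rewrite x0 /= -andbA andbb.
by rewrite /= !capE.
Qed.

End Converse.
End Relation.
End WordAlgebra.

Theorem theorem5p7 (k : fieldType) (sim : seq letter -> seq letter -> Prop)
    (sim_rel : word_relation sim) (sim_hom : homogeneous sim) :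
  graded_subbialgebra wsize (@nabla_sh k) (@iota_sh k) (@Delta_odot k)
    (@epsilon_odot k) (@Ksim k sim)
  <-> algebraic sim.
Proof.
split; first exact: algebraic_of_subbialgebra.
exact: subbialgebra_of_algebraic.
Qed.
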